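(* Let $n\ge 2$ and let $G\subsetneq\mathbb{R}^n$ be a domain. Suppose that $G$ is $\varphi$-uniform for some strictly increasing homeomorphism $\varphi:[0,\infty)\to[0,\infty)$ with $\varphi(0)=0$, and that $G$ satisfies the twisted cone condition. Then $G$ is uniform.
   Context: For a domain $G\subsetneq\mathbb{R}^n$ and $x\in G$, $\delta(x)=\delta_G(x)$ denotes the Euclidean distance from $x$ to $\partial G$. All paths are rectifiable, $\ell(\gamma)$ denotes Euclidean length, and for points $a,b$ on a path $\gamma$, $\gamma[a,b]$ is the subpath between them. The quasihyperbolic metric is $k_G(x,y)=\inf_\gamma\int_\gamma \frac{|dz|}{\delta(z)}$, the infimum over rectifiable paths $\gamma$ joining $x$ and $y$ in $G$. The domain $G$ is $\varphi$-uniform if $k_G(x,y)\le\varphi\big(\frac{|x-y|}{\min\{\delta(x),\delta(y)\}}\big)$ for all $x,y\in G$. $G$ satisfies the twisted cone condition if there is a constant $c>0$ such that every $x,y\in G$ can be joined by a rectifiable path $\gamma\subset G$ with $\min\{\ell(\gamma[x,z]),\ell(\gamma[z,y])\}\le c\,\delta(z)$ for all $z\in\gamma$. $G$ is uniform if there is $C\ge1$ such that every $x,y\in G$ can be joined by a path $\gamma\subset G$ with (i) $\ell(\gamma)\le C|x-y|$ and (ii) $\delta(z)\ge \frac1C\min\{\ell(\gamma[x,z]),\ell(\gamma[z,y])\}$ for all $z\in\gamma$. *)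

(* Defs.v *)
From HB Require Import structures.
From mathcomp Require Import all_boot all_order all_algebra.
From mathcomp Require Import all_classical all_reals all_analysis.
Set Implicit Arguments. Unset Strict Implicit. Unset Printing Implicit Defensive.
Import Order.TTheory GRing.Theory Num.Theory.
Import numFieldNormedType.Exports.
Local Open Scope classical_set_scope.
Local Open Scope ring_scope.

Section QH.
Variables (R : realType) (n : nat).
Notation V := 'rV[R]_n.

(* Euclidean norm on R^n (the library norm on matrices is the sup norm). *)
Definition enorm (v : V) : R := Num.sqrt (\sum_(i < n) v ord0 i ^+ 2).

Definition bdry (G : set V) : set V := closure G `&` ~` interior G.

Definition dist_bd (G : set V) (x : V) : R :=
  inf [set enorm (x - y) | y in bdry G].

Definition domain (G : set V) : Prop := G !=set0 /\ open G /\ connected G.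

Definition partition (a b : R) (k : nat) (t : nat -> R) : Prop :=
  t 0%N = a /\ t k = b /\ (forall i, (i < k)%N -> t i <= t i.+1).

Definition plength (g : R -> V) (a b : R) : \bar R :=
  ereal_sup [set e | exists (k : nat) (t : nat -> R), partition a b k t /\
              e = (\sum_(i < k) enorm (g (t i.+1) - g (t i)))%:E].
Arguments plength : clear implicits.

Definition path_in (G : set V) (x y : V) (g : R -> V) : Prop :=
  {within `[0, 1], continuous g} /\ g @` `[0, 1] `<=` G /\ g 0 = x /\ g 1 = y.

Definition rectifiable (g : R -> V) : Prop := (plength g 0 1 < +oo)%E.

(* Line integral with respect to arc length of a nonnegative function f along
   gamma on [0,1], defined as the supremum of lower Riemann--Stieltjes sums with
   respect to the arc length function (equal to int_gamma f |dz| for continuous f) *)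
Definition line_integral (f : V -> R) (g : R -> V) : \bar R :=
  ereal_sup [set e | exists (k : nat) (t : nat -> R), partition 0 1 k t /\
      e = (\sum_(i < k)
        ereal_inf [set (f (g u))%:E | u in `[t i, t i.+1]] * plength g (t i) (t i.+1))%E].

Definition qh_dist (G : set V) (x y : V) : \bar R :=
  ereal_inf [set line_integral (fun z => (dist_bd G z)^-1) g
            | g in [set g | path_in G x y g /\ rectifiable g]].

Definition phi_uniform (phi : R -> R) (G : set V) : Prop :=
  forall x y, G x -> G y ->
    (qh_dist G x y <= (phi (enorm (x - y) / Order.min (dist_bd G x) (dist_bd G y)))%:E)%E.

Definition twisted_cone (G : set V) : Prop :=
  exists c : R, 0 < c /\
    forall x y, G x -> G y -> exists g, path_in G x y g /\ rectifiable g /\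
      forall t, t \in `[0, 1] ->
        (Order.min (plength g 0 t) (plength g t 1) <= c%:E * (dist_bd G (g t))%:E)%E.

Definition uniform_domain (G : set V) : Prop :=
  exists C : R, 1 <= C /\
    forall x y, G x -> G y -> exists g, path_in G x y g /\
      (plength g 0 1 <= (C * enorm (x - y))%:E)%E /\
      forall t, t \in `[0, 1] ->
        ((C^-1)%:E * Order.min (plength g 0 t) (plength g t 1) <= (dist_bd G (g t))%:E)%E.

End QH.

Definition incr_homeo_nonneg (R : realType) (phi : R -> R) : Prop :=
  phi 0 = 0 /\
  (forall s t : R, 0 <= s -> s < t -> phi s < phi t) /\
  (exists psi : R -> R,
     (forall s : R, 0 <= s -> 0 <= phi s /\ 0 <= psi s /\ psi (phi s) = s /\ phi (psi s) = s) /\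
     {within `[0, +oo[, continuous phi} /\ {within `[0, +oo[, continuous psi}).

(* Main.v *)
Require Import Defs.
From HB Require Import structures.
From mathcomp Require Import all_boot all_order all_algebra.
From mathcomp Require Import all_classical all_reals all_analysis.
From mathcomp Require Import ring lra.
Set Implicit Arguments.
Unset Strict Implicit.
Unset Printing Implicit Defensive.
Import Order.TTheory GRing.Theory Num.Theory.
Import numFieldNormedType.Exports.
Local Open Scope classical_set_scope.
Local Open Scope ring_scope.

(* Let r = |x - y|. If dist(x, bd G) >= 2 r the segment [x, y] works. Otherwise
   take a twisted-cone path from x to y and let x1, y1 be the points at arc
   length r / 3 from its ends. The cone condition at these points gives
   dist(x1, bd G), dist(y1, bd G) >= r / (3 c), while |x1 - y1| <= 5 r / 3, so
   phi-uniformity bounds the quasihyperbolic distance of x1 and y1 by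
   phi (5 c). Along a path of bounded quasihyperbolic length starting at x1,
   the distance to the boundary stays comparable to dist(x1, bd G), and hence
   to r, and so does the Euclidean length; substituting such a path for the part
   of the twisted-cone path between x1 and y1 gives the required path. *)

(** * The Euclidean norm and its comparison with the sup norm *)

Section EuclideanNorm.
Variables (R : realType) (n : nat).
Implicit Types u v w : 'rV[R]_n.

Lemma enorm_ge0 v : 0 <= enorm v.
Proof. exact: sqrtr_ge0. Qed.

Lemma enorm_sqr v : enorm v ^+ 2 = \sum_(i < n) v ord0 i ^+ 2.
Proof. by rewrite sqr_sqrtr// sumr_ge0// => i _; rewrite sqr_ge0. Qed.

Lemma enormZ (a : R) v : enorm (a *: v) = `|a| * enorm v.
Proof.
rewrite /enorm -sqrtr_sqr -sqrtrM ?sqr_ge0// mulr_sumr.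
by congr Num.sqrt; apply: eq_bigr => i _; rewrite mxE exprMn.
Qed.

Lemma enormC u v : enorm (u - v) = enorm (v - u).
Proof. by rewrite -opprB -scaleN1r enormZ normrN1 mul1r. Qed.

Lemma enorm0 : enorm (0 : 'rV[R]_n) = 0.
Proof. by rewrite -(scale0r 0) enormZ normr0 mul0r. Qed.

Lemma enorm_coord v i : `|v ord0 i| <= enorm v.
Proof.
rewrite -sqrtr_sqr ler_sqrt; last by apply: sumr_ge0 => j _; rewrite sqr_ge0.
by rewrite (bigD1 i)//= lerDl sumr_ge0// => j _; rewrite sqr_ge0.
Qed.

Lemma enorm_eq0 v : enorm v = 0 -> v = 0.
Proof.
move=> v0; apply/rowP => i; rewrite mxE; apply/eqP.
by rewrite -normr_le0 -v0 enorm_coord.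
Qed.

Lemma norm_le_enorm v : `|v| <= enorm v.
Proof.
have -> : `|v| = mx_norm v by [].
rewrite mx_normrE; apply: (big_ind (fun x => x <= enorm v)).
- exact: enorm_ge0.
- by move=> x y hx hy; rewrite ge_max hx hy.
- by move=> [i j] _ /=; rewrite (ord1 i) enorm_coord.
Qed.

Lemma norm_coord v i : `|v ord0 i| <= `|v|.
Proof.
have -> : `|v| = mx_norm v by [].
by rewrite mx_normrE (bigD1 (ord0, i))//= le_max lexx.
Qed.

(** The crude factor [n] is good enough: the bound only transfers continuity from the sup norm. *)
Lemma enorm_le_norm v : enorm v <= n%:R * `|v|.
Proof.
rewrite -(@ler_pXn2r _ 2)// ?nnegrE ?enorm_ge0 ?mulr_ge0//.
rewrite enorm_sqr (@le_trans _ _ (n%:R * `|v| ^+ 2))//.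
  have -> : n%:R * `|v| ^+ 2 = \sum_(i < n) `|v| ^+ 2.
    by rewrite sumr_const card_ord mulr_natl.
  apply: ler_sum => i _; rewrite -real_normK ?num_real//.
  by rewrite lerXn2r ?nnegrE// norm_coord.
rewrite exprMn ler_wpM2r ?sqr_ge0// -natrX ler_nat.
by case: (n) => // m; rewrite expnS leq_pmulr// expn1.
Qed.

Lemma ler_enormD u v : enorm (u + v) <= enorm u + enorm v.
Proof.
set a := enorm u; set b := enorm v.
have a0 : 0 <= a := enorm_ge0 u.
have b0 : 0 <= b := enorm_ge0 v.
pose s := \sum_(i < n) u ord0 i * v ord0 i.
have E : enorm (u + v) ^+ 2 = a ^+ 2 + 2 * s + b ^+ 2.
  rewrite !enorm_sqr mulr_sumr -!big_split/=; apply: eq_bigr => i _.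
  by rewrite mxE; ring.
(* Cauchy-Schwarz [s <= a * b] in disguise: the product is a sum of squares. Dividing by [a * b]
   later requires both vectors to be nonzero. *)
have D : 0 <= 2 * (a * b) * (a * b - s).
  have -> : 2 * (a * b) * (a * b - s) =
      \sum_(i < n) (b * u ord0 i - a * v ord0 i) ^+ 2.
    have -> : 2 * (a * b) * (a * b - s) =
       b ^+ 2 * a ^+ 2 + - (2 * a * b) * s + a ^+ 2 * b ^+ 2 by ring.
    rewrite [X in b ^+ 2 * X]enorm_sqr [X in a ^+ 2 * X]enorm_sqr.
    rewrite !mulr_sumr -!big_split/=.
    by apply: eq_bigr => i _; ring.
  by apply: sumr_ge0 => i _; rewrite sqr_ge0.
have [->|u0] := eqVneq u 0; first by rewrite add0r lerDr.
have [->|v0] := eqVneq v 0; first by rewrite addr0 lerDl.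
have ab : 0 < a * b.
  rewrite mulr_gt0// lt_neqAle ?a0 ?b0 andbT eq_sym.
  - by apply: contra_neq u0 => /enorm_eq0.
  - by apply: contra_neq v0 => /enorm_eq0.
have sab : 0 <= a * b - s.
  by rewrite -(@pmulr_rge0 _ (2 * (a * b)))// mulr_gt0.
rewrite -(@ler_pXn2r _ 2)// ?nnegrE ?enorm_ge0 ?addr_ge0// E; nra.
Qed.

Lemma ler_enorm_dist u v w : enorm (u - w) <= enorm (u - v) + enorm (v - w).
Proof. by rewrite (le_trans _ (ler_enormD _ _))// addrA subrK. Qed.

End EuclideanNorm.

(** * Partitions and additivity of arc length *)

Section ArcLength.
Variables (R : realType) (n : nat).
Implicit Types (g h : R -> 'rV[R]_n) (a b c : R).

Lemma partition_mono a b k t i j : Defs.partition a b k t ->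
  (i <= j <= k)%N -> t i <= t j.
Proof.
move=> [_ [_ tm]]; elim: j => [|j IH] /andP[]; first by rewrite leqn0 => /eqP ->.
rewrite leq_eqVlt => /predU1P[->//|]; rewrite ltnS => ij jk.
by rewrite (le_trans (IH _))// ?ij ?(ltnW jk)// tm.
Qed.

Lemma partition_itv a b k t i : Defs.partition a b k t ->
  (i <= k)%N -> a <= t i <= b.
Proof.
move=> p ik; have := partition_mono p; case: p => -[<-] [<- _] tm.
by rewrite !tm// ?leqnn ?andbT ?ik.
Qed.

Lemma partition2 a b : a <= b ->
  Defs.partition a b 1 (fun i => if i is 0%N then a else b).
Proof. by move=> ab; split=> //; split=> // -[]. Qed.

Definition catp k (t s : nat -> R) i := if (i <= k)%N then t i else s (i - k)%N.

Lemma partition_cat {a b c k l t s} : Defs.partition a b k t ->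
  Defs.partition b c l s -> Defs.partition a c (k + l) (catp k t s).
Proof.
move=> [t0 [tk tm]] [s0 [sl sm]]; rewrite /catp; split=> //; split.
  case: l sl {sm} => [|l] sl; first by rewrite addn0 leqnn tk -sl.
  by rewrite leqNgt -addSnnS leq_addr/= addSnnS addKn.
move=> i ikl; case: (ltngtP i k) => ik.
- exact: tm.
- by rewrite subSn ?(ltnW ik)// sm// ltn_subLR// ltnW.
- rewrite subSn ?ik// subnn tk -s0 sm//.
  by move: ikl; rewrite ik -{1}(addn0 k) ltn_add2l.
Qed.

(** A general [nmodType] lets the identity serve both real chord sums and the extended-real sums of
    the line integral. *)
Lemma sum_catp (V : nmodType) (F : R -> R -> V) a b c k l t s :
  Defs.partition a b k t -> Defs.partition b c l s ->
  \sum_(i < k + l) F (catp k t s i) (catp k t s i.+1) =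
  \sum_(i < k) F (t i) (t i.+1) + \sum_(i < l) F (s i) (s i.+1).
Proof.
move=> [_ [tk _]] [s0 _]; rewrite big_split_ord/=; congr (_ + _).
  by apply: eq_bigr => i _; rewrite /catp ltn_ord (ltnW (ltn_ord i)).
apply: eq_bigr => i _; rewrite /catp ltnNge leq_addr/= -addnS !addKn.
case: (posnP i) => [->|i0]; first by rewrite addn0 leqnn tk s0.
by rewrite -{2}(addn0 k) leq_add2l leqNgt i0.
Qed.

Lemma plength_ge g a b k t : Defs.partition a b k t ->
  ((\sum_(i < k) enorm (g (t i.+1) - g (t i)))%:E <= plength g a b)%E.
Proof. by move=> p; apply: ereal_sup_ubound; exists k, t. Qed.

Lemma chord_le_plength g a b : a <= b ->
  ((enorm (g b - g a))%:E <= plength g a b)%E.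
Proof.
by move=> ab; have := plength_ge g (partition2 ab); rewrite big_ord1.
Qed.

Lemma plength_ge0 g a b : a <= b -> (0 <= plength g a b)%E.
Proof. by move=> /(chord_le_plength g); apply: le_trans; rewrite lee_fin enorm_ge0. Qed.

Lemma plength_le g a b M :
  (forall k t, Defs.partition a b k t ->
    ((\sum_(i < k) enorm (g (t i.+1) - g (t i)))%:E <= M)%E) ->
  (plength g a b <= M)%E.
Proof. by move=> H; apply: ge_ereal_sup => _ [k [t [p ->]]]; exact: H. Qed.

Lemma eq_plength g h a b : (forall t, a <= t <= b -> g t = h t) ->
  plength g a b = plength h a b.
Proof.
move=> gh; wlog suff : g h gh / (plength g a b <= plength h a b)%E.
  by move=> H; apply/eqP; rewrite eq_le !H// => t /gh.
apply: plength_le => k t p; apply: le_trans (plength_ge h p).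
rewrite lee_fin; apply: ler_sum => i _.
by rewrite !gh// (partition_itv p)// ltnW.
Qed.

Lemma plength_comp_le g a b (f : R -> R) :
  {homo f : x y / x <= y} ->
  (plength (g \o f) a b <= plength g (f a) (f b))%E.
Proof.
move=> fm; apply: plength_le => k t [t0 [tk tm]].
apply: (@plength_ge g (f a) (f b) k (f \o t)).
by rewrite /= -t0 -tk; split=> //; split=> // i ik; rewrite /= fm// tm.
Qed.

(** Clamping a partition of [a, c] at [b] from above and from below gives partitions of the two
    halves. Only a step across [b] is split, and there the triangle inequality applies. *)
Lemma plengthD_le g a b c : a <= b -> b <= c ->
  (plength g a c <= plength g a b + plength g b c)%E.
Proof.
move=> ab bc; apply: plength_le => k t p.
have pa : Defs.partition a b k (fun i => Num.min (t i) b).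
  case: p => t0 [tk tm]; split; first by rewrite t0 min_l.
  by split=> [|i ik]; [rewrite tk min_r|rewrite le_min !ge_min lexx tm ?orbT].
have pb : Defs.partition b c k (fun i => Num.max (t i) b).
  case: p => t0 [tk tm]; split; first by rewrite t0 max_r.
  by split=> [|i ik]; [rewrite tk max_l|rewrite ge_max !le_max lexx tm ?orbT].
apply: le_trans (leeD (plength_ge g pa) (plength_ge g pb)).
rewrite -EFinD lee_fin -big_split/=; apply: ler_sum => i _.
have := partition_mono p (i := i) (j := i.+1); rewrite leqnSn ltn_ord => /(_ isT).
have [h1|h1] := leP (t i) b; have [h2|h2] := leP (t i.+1) b => h.
- by rewrite lerDl enorm_ge0.
- by rewrite addrC ler_enorm_dist.
- by have := le_lt_trans (le_trans h h2) h1; rewrite ltxx.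
- by rewrite lerDr enorm_ge0.
Qed.

Lemma plengthD_ge g a b c : a <= b -> b <= c ->
  (plength g a b + plength g b c <= plength g a c)%E.
Proof.
move=> ab bc.
have H k t l s : Defs.partition a b k t -> Defs.partition b c l s ->
    ((\sum_(i < k) enorm (g (t i.+1) - g (t i)))%:E +
     (\sum_(i < l) enorm (g (s i.+1) - g (s i)))%:E <= plength g a c)%E.
  move=> p q; rewrite -EFinD -(sum_catp (fun x y => enorm (g y - g x)) p q).
  exact: plength_ge (partition_cat p q).
have H2 l s : Defs.partition b c l s -> (plength g a b +
     (\sum_(i < l) enorm (g (s i.+1) - g (s i)))%:E <= plength g a c)%E.
  by move=> q; rewrite -leeBrDr//; apply: plength_le => k t p; rewrite leeBrDr// H.
(* The supremum over the right half needs a finite left length to subtract. An infinite one makes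
   the length over [a, c] infinite, by [H2] with the one-step partition. *)
have [fab|] := boolP (plength g a b \is a fin_num).
  rewrite addeC -leeBrDr//; apply: plength_le => l s q.
  by rewrite leeBrDr// addeC H2.
rewrite ge0_fin_numE ?plength_ge0// -leNgt leye_eq => /eqP E.
have := H2 _ _ (partition2 bc); rewrite E addye// leye_eq => /eqP ->.
exact: leey.
Qed.

Lemma plengthD g a b c : a <= b -> b <= c ->
  plength g a c = (plength g a b + plength g b c)%E.
Proof. by move=> ab bc; apply/eqP; rewrite eq_le plengthD_le// plengthD_ge. Qed.

(** Chords are dominated by increments of [F], which telescope. Below, [F] is a jump function once
    and a linear function once. *)
Lemma plength_le_increment g (F : R -> R) a b : a <= b ->
  (forall s t, a <= s -> s <= t -> t <= b -> enorm (g t - g s) <= F t - F s) ->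
  (plength g a b <= (F b - F a)%:E)%E.
Proof.
move=> ab gF; apply: plength_le => k t p; rewrite lee_fin.
have -> : F b - F a = \sum_(i < k) (F (t i.+1) - F (t i)).
  rewrite -(big_mkord xpredT (fun i => F (t i.+1) - F (t i))) telescope_sumr//.
  by case: p => -> [-> _].
apply: ler_sum => i _.
have /andP[h1 h2] := partition_itv p (ltnW (ltn_ord i)).
have /andP[h3 h4] := partition_itv p (ltn_ord i).
by apply: gF => //; apply: (partition_mono p); rewrite leqnSn ltn_ord.
Qed.

Lemma plength_gap g a b k t : 0 <= a -> a <= b -> b <= 1 ->
  Defs.partition 0 1 k t ->
  (forall i, (i <= k)%N -> t i <= a \/ b <= t i) ->
  ((\sum_(i < k) enorm (g (t i.+1) - g (t i)))%:E <=
   plength g 0 a + (enorm (g b - g a))%:E + plength g b 1)%E.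
Proof.
move=> a0 ab b1 p gap.
(* Freezing the path at [g a] inside ]a, b[ changes nothing at the partition points and leaves a
   single jump, at [b], as its length over [a, b]. *)
pose h u := if (a < u) && (u < b) then g a else g u.
have hE u : u <= a \/ b <= u -> h u = g u.
  by rewrite /h; case: ifP => // /andP[au ub] []; rewrite leNgt ?au ?ub.
have -> : \sum_(i < k) enorm (g (t i.+1) - g (t i)) =
          \sum_(i < k) enorm (h (t i.+1) - h (t i)).
  by apply: eq_bigr => i _; rewrite !hE//; apply: gap => //; exact: ltnW.
apply: le_trans (plength_ge h p) _.
rewrite (plengthD h a0 (le_trans ab b1)) (plengthD h ab b1) addeA.
rewrite (@eq_plength h g 0 a); last by move=> u /andP[_ ua]; apply: hE; left.
rewrite (@eq_plength h g b 1); last by move=> u /andP[bu _]; apply: hE; right.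
apply: leeD => //; apply: leeD => //.
pose F u := if b <= u then enorm (g b - g a) else 0.
apply: le_trans (plength_le_increment (F := F) ab _) _; last first.
  rewrite lee_fin /F lexx; case: (leP b a) => _; last by rewrite subr0.
  by rewrite subrr enorm_ge0.
move=> s u as_ su ub; rewrite /F /h.
have [bs|sb] := leP b s.
  have -> : s = b by apply/eqP; rewrite eq_le bs (le_trans su ub).
  have -> : u = b by apply/eqP; rewrite eq_le ub (le_trans bs su).
  by rewrite ltxx andbF !subrr enorm0 lexx subrr.
have -> : (if (a < s) && true then g a else g s) = g a.
  by rewrite andbT; case: ltP => // sa; congr g; apply/eqP; rewrite eq_le as_ sa.
rewrite subr0; have [bu|ub'] := leP b u.
  by rewrite andbF; have -> : u = b by apply/eqP; rewrite eq_le ub bu.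
rewrite andbT; case: ltP => au; first by rewrite subrr enorm0.
have -> : u = a by apply/eqP; rewrite eq_le au (le_trans as_ su).
by rewrite subrr enorm0.
Qed.

End ArcLength.

(** * The arc length function of a rectifiable path *)

Section RectifiablePath.
Variables (R : realType) (n : nat) (g : R -> 'rV[R]_n).
Hypothesis rg : rectifiable g.

(** [fine] sends infinite values to 0; by rectifiability none occur for [0 <= a <= b <= 1]. *)
Definition arclen a b := fine (plength g a b).

Lemma arclenE a b : 0 <= a -> a <= b -> b <= 1 ->
  plength g a b = (arclen a b)%:E.
Proof.
move=> a0 ab b1; rewrite fineK// ge0_fin_numE ?plength_ge0//.
apply: le_lt_trans rg; rewrite (plengthD g a0 (le_trans ab b1)) (plengthD g ab b1).
rewrite addeCA leeDl// adde_ge0 ?plength_ge0//.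
Qed.

Lemma arclenD a b c : 0 <= a -> a <= b -> b <= c -> c <= 1 ->
  arclen a c = arclen a b + arclen b c.
Proof.
move=> a0 ab bc c1; apply/EFin_inj; rewrite EFinD -!arclenE//.
- exact: plengthD.
- exact: le_trans ab.
- exact: le_trans c1.
- exact: le_trans bc.
Qed.

Lemma arclen_ge_chord a b : 0 <= a -> a <= b -> b <= 1 ->
  enorm (g b - g a) <= arclen a b.
Proof. by move=> a0 ab b1; rewrite -lee_fin -arclenE// chord_le_plength. Qed.

Lemma arclen_ge0 a b : 0 <= a -> a <= b -> b <= 1 -> 0 <= arclen a b.
Proof. by move=> *; rewrite (le_trans (enorm_ge0 _) (arclen_ge_chord _ _ _)). Qed.

Lemma arclenaa a : 0 <= a <= 1 -> arclen a a = 0.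
Proof.
case/andP=> a0 a1; have := arclenD a0 (lexx a) (lexx a) a1.
by move=> /eqP; rewrite -subr_eq subrr => /eqP.
Qed.

Hypothesis cg : {within `[0, 1], continuous g}.

(* A partition almost realizing the length leaves little room for the arc
   between two neighbouring parameters: replacing that arc by its chord
   changes the length by at most the defect of the partition. *)
Lemma arclen_continuous : {within `[0, 1], continuous (arclen 0)}.
Proof.
apply/subspace_continuousP => x /=; rewrite in_itv/= => /andP[x0 x1].
apply/cvgrPdist_le => e e0.
have e20 : 0 < e / 2 by rewrite divr_gt0.
have fin01 : plength g 0 1 \is a fin_num by rewrite arclenE.
have [_ [k [t [p ->]]] tsup] := ub_ereal_sup_adherent e20 fin01.
have {}tsup : arclen 0 1 - e / 2 <= \sum_(i < k) enorm (g (t i.+1) - g (t i)).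
  by rewrite -lee_fin EFinB -arclenE// ltW.
(* One half of [e] pays for the chord, the other for the defect of the partition. *)
have small a b : 0 <= a -> a <= b -> b <= 1 -> enorm (g b - g a) <= e / 2 ->
    (forall i, (i <= k)%N -> t i <= a \/ b <= t i) -> `|arclen 0 b - arclen 0 a| <= e.
  move=> a0 ab b1 gab gap; rewrite (arclenD (lexx 0) a0 ab b1) addrC addKr.
  rewrite ger0_norm ?arclen_ge0//.
  have := plength_gap g a0 ab b1 p gap.
  rewrite (arclenE (lexx 0) a0 (le_trans ab b1)) (arclenE (le_trans a0 ab) b1)//.
  rewrite -!EFinD lee_fin => h; move: tsup.
  rewrite (arclenD (lexx 0) a0 (le_trans ab b1))// (arclenD a0 ab b1)//; lra.
(* [n.+1] rather than [n], so that dimension 0 causes no division by zero. *)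
have en0 : 0 < e / 2 / n.+1%:R by rewrite divr_gt0// ltr0n.
near=> y.
have /andP[y0 y1] : 0 <= y <= 1.
  suff : y \in `[0, 1] by rewrite in_itv.
  by near: y; apply: withinT.
have gxy : enorm (g x - g y) <= e / 2.
  apply: le_trans (enorm_le_norm _) _.
  have : `|g x - g y| <= e / 2 / n.+1%:R.
    near: y; have /subspace_continuousP/(_ x) := cg.
    by rewrite /= in_itv/= x0 x1 => /(_ isT)/cvgrPdist_le; apply.
  rewrite ler_pdivlMr ?ltr0n//; apply: le_trans.
  by rewrite mulrC ler_wpM2l// ler_nat.
(* Close to [x], no partition point lies strictly between [x] and [y]; finitely many neighbourhoods
   are intersected. *)
have gap (i : 'I_k.+1) : t i = x \/ (t i < x /\ t i < y) \/ (x < t i /\ y < t i).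
  move: i; near: y; apply: filter_forall => i; apply: cvg_within.
  have [xt|tx|<-] := ltgtP x (t i).
  - by apply: filterS (lt_nbhsl xt) => y yt; right; right.
  - by apply: filterS (lt_nbhsr tx) => y yt; right; left.
  - by apply: filterE => y; left.
have [xy|/ltW yx] := leP x y.
  rewrite distrC; apply: small; rewrite // 1?enormC// => i; rewrite -ltnS => ik.
  case: (gap (Ordinal ik)) => /= [->|[[]|[]]]; first by left.
  - by move=> /ltW; left.
  - by move=> _ /ltW; right.
apply: small; rewrite // => i; rewrite -ltnS => ik.
case: (gap (Ordinal ik)) => /= [->|[[]|[]]]; first by right.
- by move=> _ /ltW; left.
- by move=> /ltW; right.
Unshelve. all: by end_near. Qed.

(** The intermediate value theorem for [arclen 0] on [a, b], moved to base point [a] by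
    additivity. *)
Lemma arclen_IVT a b v : 0 <= a -> a <= b -> b <= 1 -> 0 <= v <= arclen a b ->
  exists2 c, a <= c <= b & arclen a c = v.
Proof.
move=> a0 ab b1 /andP[v0 vb].
have cab : {within `[a, b], continuous (arclen 0)}.
  apply: continuous_subspaceW arclen_continuous => u /=.
  by rewrite !in_itv/= => /andP[au ub]; rewrite (le_trans a0 au) (le_trans ub b1).
have ba0 : arclen 0 b = arclen 0 a + arclen a b := arclenD (lexx 0) a0 ab b1.
have : exists2 c, c \in `[a, b] & arclen 0 c = arclen 0 a + v.
  by apply: IVT => //; rewrite ge_min le_max lerDl v0/= ba0 lerD2l vb orbT.
move=> [c]; rewrite in_itv/= => /andP[ac cb] cE; exists c; first by rewrite ac cb.
have := arclenD (lexx 0) a0 ac (le_trans cb b1); rewrite cE; lra.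
Qed.

End RectifiablePath.

(** * The distance to the boundary *)

Section BoundaryDistance.
Variables (R : realType) (n : nat) (G : set 'rV[R]_n).
Implicit Types x y : 'rV[R]_n.

Lemma dist_bd_has_lbound x : has_lbound [set enorm (x - z) | z in bdry G].
Proof. by exists 0 => _ [z _ <-]; exact: enorm_ge0. Qed.

Lemma dist_bd_le x z : bdry G z -> dist_bd G x <= enorm (x - z).
Proof. by move=> Gz; apply: ge_inf; [exact: dist_bd_has_lbound|exists z]. Qed.

Lemma dist_bd_lipschitz x y : dist_bd G x <= enorm (x - y) + dist_bd G y.
Proof.
(* With an empty boundary the distance is the infimum of the empty set, which is 0. *)
have [bd0|/set0P[z Gz]] := eqVneq (bdry G) set0.
  by rewrite /dist_bd bd0 !image_set0 inf0 addr0 enorm_ge0.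
rewrite -lerBlDl; apply: lb_le_inf; first by exists (enorm (y - z)), z.
move=> _ [w Gw <-]; rewrite lerBlDl.
exact: le_trans (dist_bd_le x Gw) (ler_enorm_dist _ _ _).
Qed.

Lemma dist_bd_ge0 x : 0 <= dist_bd G x.
Proof.
have [bd0|/set0P[z Gz]] := eqVneq (bdry G) set0.
  by rewrite /dist_bd bd0 !image_set0 inf0.
by apply: lb_le_inf; [exists (enorm (x - z)), z|move=> _ [w _ <-]; exact: enorm_ge0].
Qed.

Hypothesis oG : open G.

Lemma open_bdry x : G x -> ~ bdry G x.
Proof. by move=> Gx [_]; apply; rewrite (proj1 (interior_id G) oG). Qed.

Lemma dist_bd_gt0 x : bdry G !=set0 -> G x -> 0 < dist_bd G x.
Proof.
move=> [z Gz] Gx.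
have /nbhs_ballP[e /= e0 eG] : nbhs x G by apply: open_nbhs_nbhs.
apply: lt_le_trans e0 _; apply: lb_le_inf; first by exists (enorm (x - z)), z.
move=> _ [w Gw <-]; rewrite leNgt; apply/negP => xw; apply: (open_bdry _ Gw).
by apply: eG; rewrite -ball_normE/=; exact: le_lt_trans (norm_le_enorm _) xw.
Qed.

(** Since an empty infimum is 0, one positive distance certifies a nonempty boundary. *)
Lemma dist_bd_gt0_bdry x : 0 < dist_bd G x -> bdry G !=set0.
Proof.
move=> dx; apply/set0P; apply: contraTneq dx => bd0.
by rewrite /dist_bd bd0 image_set0 inf0 ltxx.
Qed.

(** Otherwise [A] meets [G] and [closure G] in the same set, which is then nonempty, open and closed
    in [A], hence all of [A]. *)
Lemma connected_meets_bdry (A : set 'rV[R]_n) x z : connected A ->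
  A x -> G x -> A z -> ~ G z -> A `&` bdry G !=set0.
Proof.
move=> cA Ax Gx Az Gz; apply: contrapT => AG; apply: Gz.
have E : A `&` G = A; last by move: Az; rewrite -E => -[].
apply: cA; first by exists x.
  by exists G.
exists (closure G); first exact: closed_closure.
apply/seteqP; split=> y [Ay Gy]; split=> //; first exact: subset_closure.
apply: contrapT => nGy; apply: AG; exists y; split=> //; split=> //.
by rewrite (proj1 (interior_id G) oG).
Qed.

End BoundaryDistance.

(** * Lower bounds for the quasihyperbolic length of a path *)

Section Doubling.
Variables (R : realType) (n : nat) (G : set 'rV[R]_n) (g : R -> 'rV[R]_n).
Hypotheses (rg : rectifiable g) (cg : {within `[0, 1], continuous g}).
Hypothesis dg : forall t, 0 <= t <= 1 -> 0 < dist_bd G (g t).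

Let d t := dist_bd G (g t).
Let summand a b :=
  (ereal_inf [set ((dist_bd G (g u))^-1)%:E | u in `[a, b]] * plength g a b)%E.
(** A single lower sum is exhibited, so bounds over adjacent intervals add by concatenation, without
    additivity of the line integral. *)
Let qh_ge a b r := exists k t, Defs.partition a b k t /\
  (r%:E <= \sum_(i < k) summand (t i) (t i.+1))%E.

Let qh_geD a b c r s : qh_ge a b r -> qh_ge b c s -> qh_ge a c (r + s).
Proof.
move=> [k [t [p kt]]] [l [u [q lu]]]; exists (k + l)%N, (catp k t u).
by split; [exact: partition_cat q|rewrite (sum_catp _ p q) EFinD leeD].
Qed.

Let qh_ge_const a b m : 0 <= a -> a <= b -> b <= 1 -> 0 <= m ->
  (forall u, a <= u <= b -> m <= (d u)^-1) -> qh_ge a b (m * arclen g a b).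
Proof.
move=> a0 ab b1 m0 md; exists 1%N, (fun i => if i is 0%N then a else b).
split; first exact: partition2.
rewrite big_ord1 /summand (arclenE rg a0 ab b1) EFinM lee_wpmul2r//.
  by rewrite lee_fin arclen_ge0.
by apply: le_ereal_inf_tmp => _ [u +] <-; rewrite lee_fin/= in_itv/=; exact: md.
Qed.

Let qh_ge0 a b : 0 <= a -> a <= b -> b <= 1 -> qh_ge a b 0.
Proof.
move=> a0 ab b1; rewrite -(mul0r (arclen g a b)); apply: qh_ge_const => // u.
by move=> _; rewrite invr_ge0 dist_bd_ge0.
Qed.

(** The integrand is at least [(2 * e)^-1] along an arc of length [e]. *)
Let qh_ge_half a b e : 0 <= a -> a <= b -> b <= 1 -> 0 < e ->
  arclen g a b = e -> (forall u, a <= u <= b -> d u <= 2 * e) ->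
  qh_ge a b 2^-1.
Proof.
move=> a0 ab b1 e0 abe due.
have -> : 2^-1 = (2 * e)^-1 * arclen g a b by rewrite abe; field; rewrite gt_eqF.
apply: qh_ge_const => //; first by rewrite invr_ge0 mulr_ge0// ltW.
move=> u /[dup] /andP[au ub] /due duE; rewrite lef_pV2 ?posrE ?mulr_gt0//.
by apply: dg; rewrite (le_trans a0 au) (le_trans ub b1).
Qed.

Let d_lipschitz a b : 0 <= a -> a <= b -> b <= 1 ->
  d b <= d a + arclen g a b /\ d a <= d b + arclen g a b.
Proof.
move=> a0 ab b1; have := arclen_ge_chord rg a0 ab b1; have := enormC (g a) (g b).
have := dist_bd_lipschitz G (g a) (g b); have := dist_bd_lipschitz G (g b) (g a).
rewrite -/(d a) -/(d b); lra.
Qed.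

(** Note that 1 + 2 + ... + 2^(N-1) = 2^N - 1. Cut off a first arc of length [d s]: on it [d] at
    most doubles, so what remains satisfies the hypothesis for the preceding exponent at its new
    start [v]. *)
Let qh_ge_fwd N s t : 0 <= s -> s <= t -> t <= 1 ->
  (2 ^+ N - 1) * d s <= arclen g s t -> qh_ge s t (N%:R / 2).
Proof.
elim: N s => [|N IH] s s0 st t1 H; first by rewrite mul0r; exact: qh_ge0.
have ds : 0 < d s by apply: dg; rewrite s0 (le_trans st).
have p1 : 1 <= 2 ^+ N :> R by rewrite exprn_ege1// ler1n.
rewrite exprS in H.
have [v /andP[sv vt] svE] : exists2 v, s <= v <= t & arclen g s v = d s.
  by apply: arclen_IVT => //; nra.
have v1 := le_trans vt t1; have v0 := le_trans s0 sv.
rewrite -natr1 mulrDl addrC mul1r; apply: (@qh_geD _ v).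
  apply: (qh_ge_half s0 sv v1 ds svE) => u /andP[su uv].
  have [h _] := d_lipschitz s0 su (le_trans uv v1).
  have := arclen_ge0 rg (le_trans s0 su) uv v1.
  have := arclenD rg s0 su uv v1; lra.
apply: IH => //; have [h _] := d_lipschitz s0 sv v1.
have := arclenD rg s0 sv vt t1; nra.
Qed.

(** The mirror image: the arc cut off, of length [d t], is the last one. *)
Let qh_ge_bwd N s t : 0 <= s -> s <= t -> t <= 1 ->
  (2 ^+ N - 1) * d t <= arclen g s t -> qh_ge s t (N%:R / 2).
Proof.
elim: N t => [|N IH] t s0 st t1 H; first by rewrite mul0r; exact: qh_ge0.
have dt : 0 < d t by apply: dg; rewrite t1 (le_trans s0).
have p1 : 1 <= 2 ^+ N :> R by rewrite exprn_ege1// ler1n.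
rewrite exprS in H.
have [v /andP[sv vt] svE] :
    exists2 v, s <= v <= t & arclen g s v = arclen g s t - d t.
  by apply: arclen_IVT => //; nra.
have v1 := le_trans vt t1; have v0 := le_trans s0 sv.
have vtE : arclen g v t = d t by have := arclenD rg s0 sv vt t1; lra.
rewrite -natr1 mulrDl mul1r; apply: (@qh_geD _ v).
  by apply: IH => //; have [_ h] := d_lipschitz v0 vt t1; nra.
apply: (qh_ge_half v0 vt t1 dt vtE) => u /andP[vu ut].
have [_ h] := d_lipschitz (le_trans v0 vu) ut t1.
have := arclen_ge0 rg v0 vu (le_trans ut t1).
have := arclenD rg v0 vu ut t1; lra.
Qed.

(* Starting from a point at distance [m] from the boundary, each successive
   arc of length [m], [2 m], [4 m], ... contributes at least [1 / 2] to the
   quasihyperbolic length. *)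
Lemma arclen_le_dist_bd N s : 0 <= s <= 1 ->
  (line_integral (fun z => (dist_bd G z)^-1)%R g < (N%:R / 2)%:E)%E ->
  arclen g 0 1 <= 2 * 2 ^+ N * dist_bd G (g s).
Proof.
move=> /andP[s0 s1] ltN; rewrite -/(d s).
have ds : 0 < d s by apply: dg; rewrite s0.
have noQ r : N%:R / 2 <= r -> ~ qh_ge 0 1 r.
  move=> Nr [k [t [p H]]]; have : (r%:E < (N%:R / 2)%:E)%E.
    apply: le_lt_trans ltN; apply: le_trans H _.
    by apply: ereal_sup_ubound; exists k, t.
  by rewrite lte_fin ltNge Nr.
rewrite (arclenD rg (lexx 0) s0 s1 (lexx 1)).
(* The integral runs over all of [0, 1], so the lower sum on [s, 1] is padded by one bounded below
   by 0 on [0, s]. *)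
have fwd : arclen g s 1 <= 2 ^+ N * d s.
  rewrite leNgt; apply/negP => H; apply: (noQ (0 + N%:R / 2)); rewrite ?add0r//.
  rewrite -[X in qh_ge _ _ X]add0r; apply: (@qh_geD _ s); first exact: qh_ge0.
  by apply: qh_ge_fwd => //; lra.
have bwd : arclen g 0 s <= 2 ^+ N * d s.
  rewrite leNgt; apply/negP => H; apply: (noQ (N%:R / 2 + 0)); rewrite ?addr0//.
  rewrite -[X in qh_ge _ _ X]addr0; apply: (@qh_geD _ s); last exact: qh_ge0.
  by apply: qh_ge_bwd => //; lra.
lra.
Qed.

End Doubling.

(** * Segments and spliced paths *)

Section PathConstructions.
Variables (R : realType) (n : nat) (G : set 'rV[R]_n).
Implicit Types (x y : 'rV[R]_n) (g h : R -> 'rV[R]_n).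

Lemma segment_cigar x y : open G -> G x -> 2 * enorm (x - y) <= dist_bd G x ->
  exists g, [/\ path_in G x y g, (plength g 0 1 <= (enorm (x - y))%:E)%E &
    forall t, 0 <= t <= 1 -> enorm (x - y) <= dist_bd G (g t)].
Proof.
move=> oG Gx xyG; pose g (t : R) := x + t *: (y - x).
have cg : {within `[0, 1], continuous g}.
  apply: continuous_subspaceT => t.
  by apply: cvgD; [exact: cvg_cst|apply: cvgZr_tmp; exact: cvg_id].
have xg t : 0 <= t <= 1 -> enorm (x - g t) <= enorm (x - y).
  move=> /andP[t0 t1]; rewrite /g opprD addNKr -scalerN opprB enormZ ger0_norm//.
  by rewrite ler_piMl// enorm_ge0.
have g0 : g 0 = x by rewrite /g scale0r addr0.
exists g; split.
- split=> //; split; last by rewrite g0 /g scale1r addrC subrK.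
  move=> _ [t /= tI <-]; apply: contrapT => nGt.
  have cA : connected (g @` `[0, 1]).
    by apply: connected_continuous_connected cg; exact: segment_connected.
  have Ax : (g @` `[0, 1]) x by exists 0; rewrite //= in_itv/= lexx ler01.
  have At : (g @` `[0, 1]) (g t) by exists t.
  (* A boundary point [g s] on the segment would be within [enorm (x - y)] of [x] but at least twice
     as far away, so it would be [x] itself, which lies in the open set [G]. *)
  have [_ [[s /= sI <-] bs]] := connected_meets_bdry oG cA Ax Gx At nGt.
  move: sI; rewrite in_itv/= => /xg xgs; have := dist_bd_le x bs => xs.
  have r0 := enorm_ge0 (x - g s).
  have /enorm_eq0/subr0_eq xE : enorm (x - g s) = 0 by lra.
  by apply: (open_bdry oG Gx); rewrite xE.
- have -> : enorm (x - y) = 1 * enorm (x - y) - 0 * enorm (x - y).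
    by rewrite mul0r subr0 mul1r.
  apply: (plength_le_increment (F := fun t => t * enorm (x - y))) => // s t _ st _.
  rewrite /g /= opprD addrACA subrr add0r -scalerBl enormZ enormC.
  by rewrite ger0_norm ?subr_ge0//= mulrBl.
- move=> t /xg xgt; have := dist_bd_lipschitz G x (g t); lra.
Qed.

(** Outside [a, b] the parameters of [g] are kept, so the lengths of the two end pieces are exactly
    those of [g]. *)
Definition splice g h a b (t : R) :=
  if t < a then g t else if t <= b then h ((t - a) / (b - a)) else g t.

Variables (g h : R -> 'rV[R]_n) (a b : R) (x y : 'rV[R]_n).
Hypotheses (a0 : 0 <= a) (ab : a < b) (b1 : b <= 1).
Hypotheses (pg : path_in G x y g) (ph : path_in G (g a) (g b) h).

Let ba0 : 0 < b - a. Proof. by rewrite subr_gt0. Qed.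

Lemma splice_left t : t <= a -> splice g h a b t = g t.
Proof.
rewrite le_eqVlt /splice => /predU1P[->|->//].
by rewrite ltxx (ltW ab) subrr mul0r; case: ph => _ [_ []].
Qed.

Lemma splice_right t : b <= t -> splice g h a b t = g t.
Proof.
rewrite le_eqVlt /splice => /predU1P[<-|bt].
  by rewrite ltNge (ltW ab) lexx/= divff ?gt_eqF//; case: ph => _ [_ []].
by rewrite ltNge (ltW (lt_trans ab bt))/= leNgt bt.
Qed.

Lemma splice_mid t : a <= t <= b -> splice g h a b t = h ((t - a) / (b - a)).
Proof. by case/andP=> at_ tb; rewrite /splice ltNge at_ tb. Qed.

Lemma splice_mid_itv t : a <= t <= b -> 0 <= (t - a) / (b - a) <= 1.
Proof.
move=> /andP[at_ tb]; rewrite divr_ge0 ?subr_ge0//; last exact: ltW.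
by rewrite ler_pdivrMr// mul1r lerD2r.
Qed.

Lemma splice_path : path_in G x y (splice g h a b).
Proof.
have [cg [gG [g0 g1]]] := pg; have [ch [hG _]] := ph.
have cgW c d : 0 <= c -> d <= 1 -> {within `[c, d], continuous g}.
  move=> c0 d1; apply: continuous_subspaceW cg => u /=; rewrite !in_itv/=.
  by move=> /andP[cu ud]; rewrite (le_trans c0 cu) (le_trans ud d1).
split; last split; last by rewrite splice_left// splice_right.
(* Continuity is glued from three closed intervals, on each of which the splice agrees with a
   continuous map. *)
- have -> : `[0, 1]%classic = `[0, a] `|` (`[a, b] `|` `[b, 1]) :> set R.
    apply/seteqP; split=> u /=; rewrite !in_itv/=.
      move=> /andP[u0 u1]; have [ua|/ltW au] := leP u a; first by left; rewrite u0.
      by right; have [ub|/ltW bu] := leP u b; [left; rewrite au|right; rewrite bu].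
    move=> [/andP[u0 ua]|[/andP[au ub]|/andP[bu u1]]].
    + by rewrite u0 (le_trans ua) ?(le_trans (ltW ab)).
    + by rewrite (le_trans a0 au) (le_trans ub b1).
    + by rewrite u1 (le_trans _ bu)// (le_trans a0)// ltW.
  apply: withinU_continuous; [exact: itv_closed| |..].
    by apply: closedU; exact: itv_closed.
  + apply: (@subspace_eq_continuous _ _ _ g); last exact: cgW (ltW (lt_le_trans ab b1)).
    by move=> u; rewrite inE/= in_itv/= => /andP[_ ua]; exact/esym/splice_left.
  apply: withinU_continuous; [exact: itv_closed|exact: itv_closed| |].
  + apply: (@subspace_eq_continuous _ _ _ (fun t => h ((t - a) / (b - a)))).
      by move=> u; rewrite inE/= in_itv/= => abu; exact/esym/splice_mid.
    apply/subspace_continuousP => u abu P hP.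
    have cf : {for u, continuous (fun t : R => (t - a) / (b - a))}.
      by apply: cvgMl; apply: cvgB; [exact: cvg_id|exact: cvg_cst].
    have := splice_mid_itv; move: abu; rewrite /= in_itv/= => abu /(_ _ abu) uI.
    have /subspace_continuousP/(_ ((u - a) / (b - a))) := ch.
    rewrite /= in_itv/= => /(_ uI P hP) /cf /=; rewrite /within/= !nbhs_simpl/=.
    apply: filterS => v /= hv; rewrite in_itv/= => /splice_mid_itv vI.
    by apply: hv; rewrite in_itv.
  + apply: (@subspace_eq_continuous _ _ _ g); last first.
      by apply: cgW => //; rewrite (le_trans a0)// ltW.
    by move=> u; rewrite inE/= in_itv/= => /andP[bu _]; exact/esym/splice_right.
- move=> _ [u /= + <-]; rewrite in_itv/= => /andP[u0 u1].
  have Ggu : G (g u) by apply: gG; exists u; rewrite //= in_itv/= u0.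
  have [ua|/ltW au] := leP u a; first by rewrite splice_left.
  have [ub|/ltW bu] := leP u b; last by rewrite splice_right.
  rewrite splice_mid ?au//; apply: hG; exists ((u - a) / (b - a)) => //=.
  by rewrite in_itv/= splice_mid_itv ?au.
Qed.

Lemma plength_splice_left t : t <= a ->
  plength (splice g h a b) 0 t = plength g 0 t.
Proof.
by move=> ta; apply: eq_plength => u /andP[_ ut]; rewrite splice_left// (le_trans ut).
Qed.

Lemma plength_splice_right t : b <= t ->
  plength (splice g h a b) t 1 = plength g t 1.
Proof.
by move=> bt; apply: eq_plength => u /andP[tu _]; rewrite splice_right// (le_trans bt).
Qed.

Lemma plength_splice_le :
  (plength (splice g h a b) 0 1 <= plength g 0 a + plength h 0 1 + plength g b 1)%E.
Proof.
rewrite (plengthD _ a0 (ltW (lt_le_trans ab b1))) (plengthD _ (ltW ab) b1) addeA.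
rewrite plength_splice_left// plength_splice_right// leeD2r// leeD2l//.
rewrite (@eq_plength _ _ _ (h \o (fun t => (t - a) / (b - a)))); last exact: splice_mid.
apply: le_trans (plength_comp_le _ _ _ _) _.
  by move=> s t st; rewrite ler_pM2r ?invr_gt0// lerD2r.
by rewrite subrr mul0r divff// gt_eqF.
Qed.

End PathConstructions.

(** * The cone condition near the two ends of a path *)

Lemma twisted_cone_ends (R : realType) (n : nat) (G : set 'rV[R]_n) (c r : R) x y g :
  0 < c -> 0 < r -> r <= enorm (x - y) -> path_in G x y g -> rectifiable g ->
  (forall t, 0 <= t <= 1 ->
    (Order.min (plength g 0 t) (plength g t 1) <= c%:E * (dist_bd G (g t))%:E)%E) ->
  exists a b, [/\ 0 <= a, a < b <= 1,
    arclen g 0 a = r / 3, arclen g b 1 = r / 3 &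
    (forall t, 0 <= t <= a -> arclen g 0 t <= c * dist_bd G (g t)) /\
    (forall t, b <= t <= 1 -> arclen g t 1 <= c * dist_bd G (g t))].
Proof.
move=> c0 r0 rxy [cg [_ [g0 g1]]] rg tw.
have rL : r <= arclen g 0 1.
  apply: le_trans rxy _; rewrite enormC -g0 -g1.
  exact: (arclen_ge_chord rg (lexx 0) ler01 (lexx 1)).
have [a /andP[a0 a1] aE] : exists2 a, 0 <= a <= 1 & arclen g 0 a = r / 3.
  by apply: arclen_IVT => //; lra.
have aD := arclenD rg (lexx 0) a0 a1 (lexx 1).
(* The middle arc is the total minus two end pieces of length [r / 3]; as the total is at least [r],
   it is nondegenerate, whence [a < b]. *)
have [b /andP[ab b1] bE] :
    exists2 b, a <= b <= 1 & arclen g a b = arclen g 0 1 - 2 * (r / 3).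
  by apply: arclen_IVT => //; lra.
have b0 := le_trans a0 ab.
have bD := arclenD rg a0 ab b1 (lexx 1).
have twr t : 0 <= t -> t <= 1 ->
    arclen g 0 t <= c * dist_bd G (g t) \/ arclen g t 1 <= c * dist_bd G (g t).
  move=> t0 t1; have := tw t; rewrite t0 t1 => /(_ isT).
  rewrite (arclenE rg (lexx 0) t0 t1) (arclenE rg t0 t1 (lexx 1)).
  by rewrite -EFin_min -EFinM lee_fin ge_min => /orP[]; [left|right].
exists a, b; split=> //; last split.
- rewrite b1 andbT lt_neqAle ab andbT; apply/eqP => abE; move: bE.
  by rewrite -abE (arclenaa rg) ?a0 ?a1//; lra.
- lra.
(* Up to [a] the arc from 0 is the shorter one, so either branch of the minimum bounds it. *)
- move=> t /andP[t0 ta]; have t1 := le_trans ta a1.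
  have := arclenD rg (lexx 0) t0 ta a1; have := arclen_ge0 rg t0 ta a1.
  have := arclenD rg (lexx 0) t0 t1 (lexx 1).
  have [|] := twr t t0 t1; lra.
- move=> t /andP[bt t1]; have t0 := le_trans b0 bt.
  have := arclenD rg b0 bt t1 (lexx 1); have := arclen_ge0 rg b0 bt t1.
  have := arclenD rg (lexx 0) t0 t1 (lexx 1).
  have [|] := twr t t0 t1; lra.
Qed.

(** * Choice of constants and assembly of the uniform path *)

Theorem theorem1p2 (R : realType) (n : nat) (G : set 'rV[R]_n) (phi : R -> R) :
  (2 <= n)%N ->
  domain G -> G != setT ->
  incr_homeo_nonneg phi ->
  phi_uniform phi G ->
  twisted_cone G ->
  uniform_domain G.
Proof.
move=> _ [_ [oG _]] _ [phi0 [phi_incr _]] phiG [c [c0 cone]].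
have c50 : 0 < 5 * c by rewrite mulr_gt0.
(* The added 1 makes the bound on the quasihyperbolic distance strict, so that some path has
   integral below [M]. *)
pose M := phi (5 * c) + 1.
have M0 : 0 <= M by rewrite addr_ge0// -phi0 ltW// phi_incr.
have [N MN] : exists N : nat, M <= N%:R / 2.
  exists (Num.Def.archi_bound (2 * M)).
  have : 0 <= 2 * M by rewrite mulr_ge0.
  by move=> /archi_boundP; lra.
pose K : R := 2 * 2 ^+ N.
have K0 : 0 < K by rewrite mulr_gt0// exprn_gt0.
(* [C1 * r] bounds the length of the spliced path: two ends of [r / 3] and a middle of at most
   [3 * K * r]. [C2] multiplies [C1] by the bound on [r / dist_bd] along the middle. *)
pose C1 := 1 + 3 * K; pose C2 := 3 * c * (1 + K) * C1.
have C10 : 0 < C1 by rewrite /C1; lra.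
have C20 : 0 < C2 by rewrite !mulr_gt0//; lra.
pose C := 1 + C1 + c + C2.
have C1C : C1 <= C by rewrite /C; lra.
have cC : c <= C by rewrite /C; lra.
have C2C : C2 <= C by rewrite /C; lra.
have C_ge1 : 1 <= C by rewrite /C; lra.
have C0 : 0 < C by lra.
exists C; split=> // x y Gx Gy; set r := enorm (x - y).
have r0 : 0 <= r := enorm_ge0 _.
have [xr|xr] := leP (2 * r) (dist_bd G x).
  have [g [pg gr gd]] := segment_cigar oG Gx xr; exists g; split=> //.
  split; first by apply: le_trans gr _; rewrite lee_fin ler_peMl.
  have rg : rectifiable g by apply: le_lt_trans gr _; rewrite ltry.
  move=> t; rewrite in_itv/= => /andP[t0 t1].
  rewrite (arclenE rg (lexx 0) t0 t1) (arclenE rg t0 t1 (lexx 1)).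
  rewrite -EFin_min -EFinM lee_fin mulrC ler_pdivrMr//.
  have lr : arclen g 0 t <= r.
    rewrite -lee_fin -(arclenE rg)//; apply: le_trans gr.
    by rewrite (plengthD g t0 t1) leeDl// plength_ge0.
  have dt : r <= dist_bd G (g t) by apply: gd; rewrite t0.
  apply: (@le_trans _ _ r); first by rewrite ge_min lr.
  by apply: le_trans dt _; rewrite ler_peMr// dist_bd_ge0.
(* The case [x = y] was covered by the segment. *)
have {}r0 : 0 < r.
  by have := dist_bd_ge0 G x; lra.
have [g [pg [rg tw]]] := cone x y Gx Gy.
have {}tw t : 0 <= t <= 1 ->
    (Order.min (plength g 0 t) (plength g t 1) <= c%:E * (dist_bd G (g t))%:E)%E.
  by move=> tI; apply: tw; rewrite in_itv.
have [a [b [a0 /andP[ab b1] aE bE [cona conb]]]] :=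
  twisted_cone_ends c0 r0 (lexx r) pg rg tw.
have a1 : a <= 1 by rewrite (le_trans (ltW ab)).
have b0 : 0 <= b by rewrite (le_trans a0)// ltW.
have [_ [gG [g0 g1]]] := pg.
have Gg t : 0 <= t <= 1 -> G (g t).
  by move=> tI; apply: gG; exists t; rewrite //= in_itv.
have Ga : G (g a) by apply: Gg; rewrite a0.
have Gb : G (g b) by apply: Gg; rewrite b0.
have da : r / 3 <= c * dist_bd G (g a) by rewrite -aE cona// a0 lexx.
have db : r / 3 <= c * dist_bd G (g b) by rewrite -bE conb// b1 lexx.
have da0 : 0 < dist_bd G (g a) by rewrite -(pmulr_rgt0 _ c0); lra.
have db0 : 0 < dist_bd G (g b) by rewrite -(pmulr_rgt0 _ c0); lra.
have bdG := dist_bd_gt0_bdry da0.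
have xa : enorm (x - g a) <= r / 3.
  by rewrite enormC -aE -{1}g0 arclen_ge_chord.
have yb : enorm (g b - y) <= r / 3.
  by rewrite enormC -bE -{1}g1 arclen_ge_chord.
have gab : enorm (g a - g b) <= 5 / 3 * r.
  have := ler_enorm_dist (g a) x (g b); have := ler_enorm_dist x y (g b).
  rewrite -/r (enormC (g a) x) (enormC y); lra.
have kM : (qh_dist G (g a) (g b) < M%:E)%E.
  apply: le_lt_trans (phiG _ _ Ga Gb) _; rewrite lte_fin /M.
  have m0 : 0 < Order.min (dist_bd G (g a)) (dist_bd G (g b)).
    by rewrite lt_min da0.
  have : enorm (g a - g b) / Order.min (dist_bd G (g a)) (dist_bd G (g b)) <= 5 * c.
    by rewrite ler_pdivrMr//; case: (leP (dist_bd G (g a))) => _; lra.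
  rewrite le_eqVlt => /predU1P[->|lt5]; first by rewrite ltrDl.
  have := phi_incr _ _ _ lt5; rewrite divr_ge0 ?enorm_ge0 ?ltW// => /(_ isT).
  lra.
have [_ [h [ph rh] <-] hM] := ereal_inf_lt kM.
have [ch [hG [h0 h1]]] := ph.
have dh t : 0 <= t <= 1 -> 0 < dist_bd G (h t).
  by move=> tI; apply: dist_bd_gt0 => //; apply: hG; exists t.
have hK s : 0 <= s <= 1 -> arclen h 0 1 <= K * dist_bd G (h s).
  move=> sI; apply: (arclen_le_dist_bd rh ch dh) => //.
  by apply: lt_le_trans hM _; rewrite lee_fin.
(* The segment case having failed, [dist_bd G x < 2 * r]; moving to [g a] adds at most [r / 3]. *)
have dar : dist_bd G (g a) <= 3 * r.
  have := dist_bd_lipschitz G (g a) x; rewrite enormC; lra.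
have hr : arclen h 0 1 <= 3 * K * r.
  have := hK 0; rewrite lexx ler01 h0 => /(_ isT); nra.
(* From [h s] back to [g a] the distance to the boundary grows by at most the length of [h], itself
   at most [K] times the distance at [h s]; and [da] bounds [r] by the distance at [g a]. *)
have hd s : 0 <= s <= 1 -> r <= 3 * c * (1 + K) * dist_bd G (h s).
  move=> /[dup] /andP[s0 s1] /hK hs.
  have := dist_bd_lipschitz G (g a) (h s).
  have := arclen_ge_chord rh (lexx 0) s0 s1; rewrite h0 enormC.
  have := arclenD rh (lexx 0) s0 s1 (lexx 1).
  have := arclen_ge0 rh s0 s1 (lexx 1); move=> e1 e2 e3 e4.
  have : dist_bd G (g a) <= (1 + K) * dist_bd G (h s) by lra.
  by rewrite -(ler_pM2l c0); lra.
pose w := splice g h a b.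
have pw : path_in G x y w := splice_path a0 ab b1 pg ph.
have lw : (plength w 0 1 <= (C1 * r)%:E)%E.
  apply: le_trans (plength_splice_le a0 ab b1 ph) _.
  rewrite (arclenE rg (lexx 0) a0 a1) (arclenE rh (lexx 0) ler01 (lexx 1)).
  rewrite (arclenE rg b0 b1 (lexx 1)) aE bE -!EFinD lee_fin /C1; lra.
have rw : rectifiable w by apply: le_lt_trans lw _; rewrite ltry.
exists w; split=> //; split.
  by apply: le_trans lw _; rewrite lee_fin ler_pM2r.
move=> t; rewrite in_itv/= => /andP[t0 t1].
rewrite (arclenE rw (lexx 0) t0 t1) (arclenE rw t0 t1 (lexx 1)).
rewrite -EFin_min -EFinM lee_fin mulrC ler_pdivrMr// ge_min mulrC.
have dC k : k <= C -> k * dist_bd G (w t) <= C * dist_bd G (w t).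
  by move=> kC; rewrite ler_wpM2r// dist_bd_ge0.
have [ta|/ltW at_] := leP t a.
  apply/orP; left; apply: le_trans (dC c cC).
  rewrite /arclen (plength_splice_left ab ph ta) /w (splice_left ab ph ta).
  by apply: cona; rewrite t0.
have [bt|/ltW tb] := leP b t.
  apply/orP; right; apply: le_trans (dC c cC).
  rewrite /arclen (plength_splice_right ab ph bt) /w (splice_right ab ph bt).
  by apply: conb; rewrite bt.
(* In the middle no arc need be compared with the other: even the total length is at most [C1 * r],
   and [hd] bounds [r]. *)
apply/orP; left; apply: le_trans (dC C2 C2C).
have tI : a <= t <= b by rewrite at_.
have lt_r : arclen w 0 t <= C1 * r.
  rewrite -lee_fin -(arclenE rw)//; apply: le_trans lw.
  by rewrite (plengthD w t0 t1) leeDl// plength_ge0.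
apply: le_trans lt_r _; rewrite /w splice_mid//.
have := hd _ (splice_mid_itv ab tI); rewrite -(ler_pM2l C10) => /le_trans; apply.
by rewrite mulrA (mulrC C1).
Qed.
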